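(* Let $n \geqslant 8$ be an integer, let $e$ be a random vector uniformly distributed on the unit Euclidean sphere $\{x\in\mathbb{R}^n : \|x\|_2 = 1\}$, and let $s\in\mathbb{R}^n$ be a (deterministic) vector. Then for every $q$ with $2\leqslant q\leqslant\infty$, $$\mathbb{E}\left[\|e\|_q^2\right] \leqslant \min\{q-1,\ 16\ln n - 8\}\, n^{\frac{2}{q}-1},$$ and for every $q$ with $2\leqslant q\leqslant\infty$, $$\mathbb{E}\left[\langle s, e\rangle^2\,\|e\|_q^2\right] \leqslant \sqrt{3}\,\|s\|_2^2\,\min\{2q-1,\ 32\ln n - 8\}\, n^{\frac{2}{q}-2}.$$
   Context: For $x=(x_1,\dots,x_n)^\top\in\mathbb{R}^n$, $\|x\|_q=\left(\sum_{k=1}^n|x_k|^q\right)^{1/q}$ for real $q\geqslant 1$, and $\|x\|_\infty=\max_{1\leqslant i\leqslant n}|x_i|$. $\langle\cdot,\cdot\rangle$ is the standard Euclidean inner product on $\mathbb{R}^n$, $\ln$ is the natural logarithm, and $\mathbb{E}$ denotes expectation with respect to $e$. The exponent $q$ ranges over all real numbers $q\geqslant 2$ together with $q=\infty$. For $q=\infty$ the conventions are $2/q=0$ and $q-1=2q-1=+\infty$, so that the two minima equal $16\ln n-8$ and $32\ln n-8$ respectively. *)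

(* Defs.v *)
From HB Require Import structures.
From mathcomp Require Import all_boot all_order all_algebra.
From mathcomp Require Import all_classical all_reals all_analysis.

Set Implicit Arguments.
Unset Strict Implicit.
Unset Printing Implicit Defensive.

Import Order.TTheory GRing.Theory Num.Theory.
Import numFieldNormedType.Exports.

Local Open Scope classical_set_scope.
Local Open Scope ring_scope.

(* The value at [-oo] is junk; only exponents [1 <= q <= +oo] are meaningful.
   The norms are nonnegative, so starting the maximum from 0 is harmless. *)
Definition lqnorm (R : realType) (n : nat) (q : \bar R) (x : 'cV[R]_n) : R :=
  match q with
  | r%:E => (\sum_(k < n) `|x k 0| `^ r) `^ r^-1
  | +oo%E => \big[Num.max/0]_(k < n) `|x k 0|
  | -oo%E => 0
  end.

Definition inner (R : realType) (n : nat) (x y : 'cV[R]_n) : R :=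
  \sum_(k < n) x k 0 * y k 0.

Definition borel (R : realType) (n : nat) : set (set 'cV[R]_n) :=
  <<s [set U : set 'cV[R]_n | open U] >>.

Definition orthogonal_mx (R : realType) (n : nat) (Q : 'M[R]_n) : Prop :=
  Q^T *m Q = 1%:M.

(* The uniform distribution on the unit Euclidean sphere (the normalized
   surface measure) is the rotation-invariant Borel probability measure
   carried by the sphere. *)
Definition uniform_on_sphere (d : measure_display) (T : measurableType d)
    (R : realType) (P : probability T R) (n : nat) (e : T -> 'cV[R]_n) : Prop :=
  [/\ (forall B, borel B -> measurable (e @^-1` B)),
      {ae P, forall w, lqnorm 2%:E (e w) = 1} &
      (forall Q, orthogonal_mx Q -> forall B, borel B ->
         P [set w | B (Q *m e w)] = P [set w | B (e w)])].

(* Main.v *)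
Require Import Defs.
From HB Require Import structures.
From mathcomp Require Import all_boot all_order all_algebra.
From mathcomp Require Import all_classical all_reals all_analysis.
From mathcomp Require Import measurable_realfun.
From mathcomp Require Import ring lra.
Import Order.TTheory GRing.Theory Num.Theory.
Import numFieldNormedType.Exports.
Local Open Scope classical_set_scope.
Local Open Scope ring_scope.

Set Implicit Arguments.
Unset Strict Implicit.
Unset Printing Implicit Defensive.

(** The key estimate is that a component [U] of the random vector along a unit
    vector [u] satisfies [E |U| ^ p <= ((p - 1) / n) ^ (p / 2)] for every real
    [p >= 2] ([absmoment_le]).

    It comes from the invariance under reflections alone. If [u] and [v] are
    orthogonal, the reflection along [v] shows that [phi(<u, e>) <v, e>] has mean
    zero for every bounded Borel [phi] ([Ex_orthogonal]). Applied to
    [phi(a) = a |a| ^ (p - 2)] and to the orthogonal pair [u + t w] and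
    [w - t |w|^2 u], where [w] is orthogonal to [u], and differentiated at
    [t = 0], this is an integration by parts formula,
    [|w|^2 E |U| ^ p = (p - 1) E (|U| ^ (p - 2) W ^ 2)] with [W = <w, e>], of
    which [moment_by_parts] is the upper bound. Summed over directions orthogonal to [u] it becomes the
    recursion [(n + p - 2) E |U| ^ p <= (p - 1) E |U| ^ (p - 2)]
    ([moment_recursion]), and Jensen's inequality bounds the right-hand side by
    a power of [E |U| ^ p] itself, which closes the estimate.

    Jensen's inequality for the power [2 / q] then turns the sum of the moments
    of order [q] of the coordinates into the bound on the squared norm
    ([Ex_sqr_lqnorm_le]). The weighted bound follows by Cauchy-Schwarz from
    [E <s, e> ^ 4 <= 3 |s| ^ 4 / n ^ 2] ([fourth_moment_le]) and from a bound on
    the fourth power of the norm through the moments of order [2 q]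
    ([Ex_lqnorm4_le]). For large [q], infinity included, the norm is compared
    with the one of exponent [2 ln n], for which [n ^ (2 / q)] is the constant
    [e]; this produces the logarithmic terms of the minima. *)

(** * Inequalities for real powers *)

Section RealInequalities.
Context {R : realType}.
Implicit Types a b c y z m r x : R.

(** A concave power lies below its tangent at 1; this is the weighted AM-GM
    inequality for [y] and [1], that is, Young's inequality. *)
Lemma powR_le_tangent1 r y : 0 <= r -> r <= 1 -> 0 <= y ->
  y `^ r <= 1 + r * (y - 1).
Proof.
rewrite le_eqVlt => /predU1P[<- _ _|r0]; first by rewrite powRr0 mul0r addr0.
rewrite le_eqVlt => /predU1P[-> y0|r1 y0]; first by rewrite powRr1// mul1r addrC subrK.
have s0 : 0 < 1 - r by rewrite subr_gt0.
have := @conjugate_powR R (y `^ r) 1 r^-1 (1 - r)^-1 (powR_ge0 _ _) ler01.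
rewrite !invr_gt0 => /(_ r0 s0); rewrite !invrK.
rewrite (addrC r) subrK => /(_ erefl).
rewrite -powRrM mulfV ?gt_eqF// powRr1// powR1 mulr1 mul1r => /le_trans; apply.
lra.
Qed.

(** The tangent at [m]. Taking expectations with [m] an upper bound of the mean
    yields Jensen's inequality. *)
Lemma powR_le_tangent r m z : 0 <= r -> r <= 1 -> 0 < m -> 0 <= z ->
  z `^ r <= m `^ r * (1 + r * (z / m - 1)).
Proof.
move=> r0 r1 m0 z0; rewrite -{1}(divfK (lt0r_neq0 m0) z) mulrC.
have zm0 : 0 <= z / m by rewrite divr_ge0// ltW.
by rewrite powRM ?(ltW m0)// ler_wpM2l ?powR_ge0// powR_le_tangent1.
Qed.

(** The convex power of exponent [r + 1] lies above its tangent at [a]. The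
    tangent inequality for the concave power of exponent [1 / (r + 1)], taken
    at [(b / a) ^ (r + 1)], says exactly this. *)
Lemma powR_sub_le r a b : 0 <= r -> 0 <= b -> b <= a ->
  a * a `^ r - b * b `^ r <= (r + 1) * ((a - b) * a `^ r).
Proof.
move=> r0 b0 ba.
have [a0|a0] := leP a 0.
  have -> : a = 0 by apply: le_anti; rewrite a0 (le_trans b0).
  have -> : b = 0 by apply: le_anti; rewrite b0 (le_trans ba).
  by rewrite !mul0r subrr mul0r mulr0.
have r1 : 0 < r + 1 by lra.
have y0 : 0 <= b / a by rewrite divr_ge0// ltW.
have := @powR_le_tangent1 (r + 1)^-1 ((b / a) `^ (r + 1)).
rewrite invr_ge0 (ltW r1) invf_le1// lerDr r0 powR_ge0 => /(_ isT isT isT).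
rewrite -powRrM mulfV ?gt_eqF// powRr1// powRM ?invr_ge0 ?(ltW a0)//.
have -> : a^-1 `^ (r + 1) = (a `^ (r + 1))^-1.
  by rewrite -powRN -mulN1r powRrM powR_inv1// ltW.
have ar : 0 < a `^ (r + 1) by exact: powR_gt0.
rewrite -(ler_pM2l (mulr_gt0 r1 ar)).
have aE : a * a `^ r = a `^ (r + 1).
  by rewrite -(@mulr_powRB1 _ a (r + 1)) ?addrK// ltW.
have bE : b * b `^ r = b `^ (r + 1).
  by rewrite -(@mulr_powRB1 _ b (r + 1)) ?addrK.
have -> : (r + 1) * a `^ (r + 1) * (b / a) = (r + 1) * a `^ r * b.
  by rewrite -aE; field; rewrite gt_eqF.
have -> : (r + 1) * a `^ (r + 1) * (1 + (r + 1)^-1 * (b `^ (r + 1) * (a `^ (r + 1))^-1 - 1))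
   = (r + 1) * a `^ (r + 1) + b `^ (r + 1) - a `^ (r + 1).
  by field; rewrite !gt_eqF.
by rewrite bE -aE; lra.
Qed.

(** The odd power function of degree [r + 1]; up to the factor [r + 2] it is
    the derivative of the even power of degree [r + 2]. *)
Definition spow r x := x * `|x| `^ r.

Lemma spowN r x : spow r (- x) = - spow r x.
Proof. by rewrite /spow normrN mulNr. Qed.

(** The odd power has derivative of absolute value at most [(r + 1) c ^ r]
    between [-c] and [c]. For arguments of the same sign this is the tangent inequality;
    for opposite signs each term is bounded separately. *)
Lemma spow_lipschitz r c a b : 0 <= r -> `|a| <= c -> `|b| <= c ->
  `|spow r a - spow r b| <= (r + 1) * `|a - b| * c `^ r.
Proof.
move=> r0.
wlog ba : a b / `|b| <= `|a|.
  move=> H ac bc; have /orP[h|h] := le_total `|b| `|a|; first exact: H.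
  by rewrite distrC (distrC a); exact: H.
wlog a0 : a b ba / 0 <= a.
  move=> H ac bc; have /orP[h|h] := le_total 0 a; first exact: H.
  have := H (- a) (- b); rewrite !normrN !spowN -!opprD !normrN oppr_ge0.
  by move=> /(_ ba h ac bc).
move=> ac bc.
suff h : `|spow r a - spow r b| <= (r + 1) * `|a - b| * a `^ r.
  apply: le_trans h _; apply: ler_wpM2l; first by rewrite mulr_ge0//; lra.
  rewrite (ger0_norm a0) in ac.
  by apply: ge0_ler_powR; rewrite ?nnegrE// (le_trans a0).
rewrite /spow (ger0_norm a0) -mulrA; rewrite (ger0_norm a0) in ba.
have ar0 := powR_ge0 a r.
have br : `|b| `^ r <= a `^ r by apply: ge0_ler_powR; rewrite ?nnegrE.
have [b0|b0] := leP 0 b.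
  rewrite (ger0_norm b0) in ba br *.
  rewrite !ger0_norm ?subr_ge0//; last by rewrite ler_pM ?powR_ge0.
  exact: powR_sub_le.
have bb := powR_ge0 `|b| r.
have ab0 : 0 <= a - b by lra.
have aa0 : 0 <= a * a `^ r by rewrite mulr_ge0.
have bb0 : 0 <= - b * `|b| `^ r by rewrite mulr_ge0//; lra.
rewrite (ger0_norm ab0) ger0_norm; last by lra.
have h1 : - b * `|b| `^ r <= - b * a `^ r by rewrite ler_wpM2l//; lra.
have h2 : 0 <= r * ((a - b) * a `^ r) by rewrite !mulr_ge0//; lra.
by lra.
Qed.

(** For [r <= 1] the increment is at most [t ^ r] by subadditivity, for [1 < r]
    the tangent at [u + t] bounds it by [r (B + 1) ^ (r - 1) t]. *)
Lemma powR_uniformly_continuous r B (eps : R) : 0 <= r -> 0 < eps ->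
  exists delta, [/\ 0 < delta, delta <= 1 &
    forall u t, 0 <= u -> u <= B -> 0 <= t -> t <= delta ->
      (u + t) `^ r <= u `^ r + eps].
Proof.
move=> r0 eps0.
have [r1|r1] := leP r 1.
  have [->|rn0] := eqVneq r 0.
    exists 1; split => // u t *; rewrite !powRr0; lra.
  exists (Num.min 1 (eps `^ r^-1)); split.
  - by rewrite lt_min ltr01 powR_gt0.
  - by rewrite ge_min lexx.
  move=> u t u0 _ t0; rewrite le_min => /andP[_ te].
  have rp : 0 < r by rewrite lt_neqAle eq_sym rn0.
  have tr : t `^ r <= eps.
    have : t `^ r <= (eps `^ r^-1) `^ r.
      by apply: ge0_ler_powR; rewrite ?nnegrE// powR_ge0.
    by rewrite -powRrM mulVf// powRr1// ltW.
  apply: (@le_trans _ _ (u `^ r + t `^ r)); last by rewrite lerD2l.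
  have [ut0|ut0] := leP (u + t) 0.
    have -> : u = 0 by lra.
    have -> : t = 0 by lra.
    by rewrite addr0 lerDl powR_ge0.
  (* Subadditivity: each share z / (u + t), being at most 1, is below its power. *)
  have sub z : 0 <= z -> z <= u + t -> z / (u + t) * (u + t) `^ r <= z `^ r.
    move=> z0 zu; have [->|zn0] := eqVneq z 0; first by rewrite !mul0r powR_ge0.
    rewrite -[leRHS](_ : (z / (u + t)) `^ r * (u + t) `^ r = _).
      rewrite ler_wpM2r ?powR_ge0// ger1_powR// divr_gt0//=.
        by rewrite ler_pdivrMr// mul1r.
      by rewrite lt_neqAle eq_sym zn0.
    by rewrite -powRM ?divfK ?gt_eqF// ?divr_ge0// ltW.
  have := lerD (sub u u0 (_ : u <= u + t)) (sub t t0 (_ : t <= u + t)).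
  rewrite -mulrDl -mulrDl mulfV ?gt_eqF// mul1r; apply; lra.
have [B0|B0] := ltP B 0.
  by exists 1; split => // u t u0 uB; exfalso; lra.
pose C := r * (B + 1) `^ (r - 1).
have C0 : 0 < C by rewrite mulr_gt0 ?powR_gt0//; lra.
exists (Num.min 1 (eps / C)); split.
- by rewrite lt_min ltr01 divr_gt0.
- by rewrite ge_min lexx.
move=> u t u0 uB t0; rewrite le_min => /andP[t1 te].
have utu : u <= u + t by lra.
have s0 : 0 <= r - 1 by lra.
have := @powR_sub_le (r - 1) (u + t) u s0 u0 utu.
have p0 : 0 < r by lra.
rewrite !mulr_powRB1//; last lra.
rewrite subrK (addrC u t) addrK (addrC t u) lerBlDl => /le_trans; apply.
rewrite lerD2l.
have h : (u + t) `^ (r - 1) <= (B + 1) `^ (r - 1).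
  by apply: ge0_ler_powR; rewrite ?nnegrE; lra.
apply: (@le_trans _ _ (t * C)); last by rewrite -ler_pdivlMr.
by rewrite /C mulrCA ler_wpM2l// ?ler_wpM2l//; lra.
Qed.

End RealInequalities.

(** * The inner product and reflections *)

Section InnerProduct.
Context {R : realType} {n : nat}.
Implicit Types (u v x : 'cV[R]_n).

Lemma inner_ge0 x : 0 <= inner x x.
Proof. by apply: sumr_ge0 => k _; rewrite -expr2 sqr_ge0. Qed.

Lemma lqnorm2E x : lqnorm 2%:E x = Num.sqrt (inner x x).
Proof.
rewrite /lqnorm powR12_sqrt; last by apply: sumr_ge0 => k _; exact: powR_ge0.
congr Num.sqrt; apply: eq_bigr => k _.
by rewrite powR_mulrn// real_normK ?num_real// expr2.
Qed.

Lemma innerC u v : inner u v = inner v u.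
Proof. by apply: eq_bigr => k _; rewrite mulrC. Qed.

Lemma innerDl u v x : inner (u + v) x = inner u x + inner v x.
Proof. by rewrite -big_split; apply: eq_bigr => k _ /=; rewrite mxE mulrDl. Qed.

Lemma innerZl (c : R) u x : inner (c *: u) x = c * inner u x.
Proof. by rewrite /inner mulr_sumr; apply: eq_bigr => k _; rewrite mxE mulrA. Qed.

Lemma innerE u x : inner u x = (u^T *m x) 0 0.
Proof. by rewrite mxE; apply: eq_bigr => k _; rewrite mxE. Qed.

Lemma inner_delta k x : inner (delta_mx k 0) x = x k 0.
Proof.
rewrite /inner (bigD1 k)//= mxE !eqxx mul1r big1 ?addr0// => i ik.
by rewrite mxE (negPf ik) mul0r.
Qed.

Lemma inner_eq0 v : inner v v = 0 -> v = 0.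
Proof.
move=> v0; apply/matrixP => i j; rewrite ord1 mxE; apply/eqP; rewrite -sqrf_eq0.
move/eqP: v0; rewrite /inner psumr_eq0 => [/allP/(_ i)|k _]; last exact: sqr_ge0.
by rewrite mem_index_enum expr2; exact.
Qed.

Lemma inner_sphere_coord x k : inner x x = 1 -> `|x k 0| <= 1.
Proof.
move=> x1; rewrite -(@ler_pXn2r _ 2)// ?nnegrE// expr1n real_normK ?num_real//.
rewrite -x1 /inner (bigD1 k)//= -expr2 lerDl sumr_ge0// => i _.
by rewrite -expr2 sqr_ge0.
Qed.

(** The vectors [delta_k - u_k u] are the projections of the standard basis to
    the hyperplane orthogonal to [u]; together they play the part of an
    orthonormal basis of it. *)
Lemma sum_inner_tangent u x : inner u u = 1 ->
  \sum_(k < n) inner (delta_mx k 0 - u k 0 *: u) x ^+ 2 =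
  inner x x - inner u x ^+ 2.
Proof.
move=> u1.
transitivity (\sum_(k < n) (x k 0 * x k 0 - 2 * inner u x * (u k 0 * x k 0)
   + inner u x ^+ 2 * (u k 0 * u k 0))).
  apply: eq_bigr => k _.
  by rewrite -scaleNr innerDl innerZl inner_delta; ring.
rewrite big_split /= sumrB -!mulr_sumr -/(inner x x) -/(inner u x) -/(inner u u) u1.
ring.
Qed.

(** The Householder reflection in the hyperplane orthogonal to [v]; it is the
    identity matrix when [v = 0]. *)
Definition reflection (v : 'cV[R]_n) : 'M[R]_n :=
  1%:M - (2 / inner v v) *: (v *m v^T).

Lemma reflectionE v x : reflection v *m x = x - (2 * inner v x / inner v v) *: v.
Proof.
rewrite mulmxBl mul1mx -scalemxAl -mulmxA; congr (_ - _).
have -> : v^T *m x = (inner v x)%:M by rewrite [LHS]mx11_scalar -innerE.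
by rewrite mul_mx_scalar scalerA mulrAC.
Qed.

Lemma reflection_orthogonal v : inner v v != 0 -> orthogonal_mx (reflection v).
Proof.
move=> v0; rewrite /orthogonal_mx.
have -> : (reflection v)^T = reflection v.
  by rewrite /reflection linearB /= linearZ /= trmx_mul trmxK trmx1.
rewrite /reflection mulmxBl mul1mx mulmxBr mulmx1 -scalemxAl -scalemxAr.
have -> : v *m v^T *m (v *m v^T) = inner v v *: (v *m v^T).
  rewrite -mulmxA (mulmxA v^T) [v^T *m v]mx11_scalar -innerE.
  by rewrite mul_scalar_mx -scalemxAr.
rewrite !scalerA -addrA -[RHS]addr0; congr (_ + _).
rewrite -scalerBl -opprD -scalerDl (_ : _ + _ = 0) ?scale0r ?oppr0//.
by field.
Qed.

End InnerProduct.

(** * Bounded Borel functions on the sphere *)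

(** Column vectors with the Borel sigma-algebra as their measurable structure,
    so that measurability of real functions of a vector can be stated. *)
Definition borelCol (R : realType) (n : nat) : Type :=
  g_sigma_algebraType [set U : set 'cV[R]_n | open U].
HB.instance Definition _ (R : realType) (n : nat) :=
  Measurable.copy (borelCol R n) (g_sigma_algebraType [set U : set 'cV[R]_n | open U]).

(** The test functions. A bound is required on the unit sphere only, since the
    random vector stays there almost surely. *)
Definition admissible (R : realType) (n : nat) (g : 'cV[R]_n -> R) : Prop :=
  measurable_fun [set: borelCol R n] g /\
  exists2 C, 0 <= C & forall x, inner x x = 1 -> `|g x| <= C.

Definition sphere_mean (R : realType) (n : nat) (d : measure_display)
    (T : measurableType d) (P : probability T R) (e : T -> 'cV[R]_n)
    (g : 'cV[R]_n -> R) : R :=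
  \int[P]_w g (e w).

Section Admissible.
Context {R : realType} {n : nat}.
Implicit Types (f g : 'cV[R]_n -> R) (u v x : 'cV[R]_n).

Lemma admissible_cst (c : R) : @admissible R n (fun=> c).
Proof. by split; [exact: measurable_cst|exists `|c|]. Qed.

Lemma admissible_add f g : admissible f -> admissible g ->
  admissible (fun x => f x + g x).
Proof.
move=> [mf [C C0 fC]] [mg [D D0 gD]]; split; first exact: measurable_funD.
exists (C + D) => [|x x1]; first exact: addr_ge0.
by rewrite (le_trans (ler_normD _ _))// lerD// ?fC// gD.
Qed.

Lemma admissible_mul f g : admissible f -> admissible g ->
  admissible (fun x => f x * g x).
Proof.
move=> [mf [C C0 fC]] [mg [D D0 gD]]; split; first exact: measurable_funM.
exists (C * D) => [|x x1]; first exact: mulr_ge0.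
by rewrite normrM ler_pM ?fC ?gD.
Qed.

Lemma admissible_scale (c : R) f : admissible f -> admissible (fun x => c * f x).
Proof. by apply: admissible_mul; exact: admissible_cst. Qed.

Lemma admissible_exp k f : admissible f -> admissible (fun x => f x ^+ k).
Proof.
move=> af; elim: k => [|k IH].
  by under eq_fun do rewrite expr0; exact: admissible_cst.
by under eq_fun do rewrite exprS; exact: admissible_mul.
Qed.

Lemma admissible_norm f : admissible f -> admissible (fun x => `|f x|).
Proof.
move=> [mf [C C0 fC]]; split; first exact: measurableT_comp.
by exists C => // x x1; rewrite normr_id fC.
Qed.

Lemma admissible_powR r f : 0 <= r -> (forall x, 0 <= f x) -> admissible f ->
  admissible (fun x => f x `^ r).
Proof.
move=> r0 f0 [mf [C C0 fC]]; split.
  exact: (measurableT_comp (measurable_powR r)).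
exists (C `^ r) => [|x x1]; first exact: powR_ge0.
rewrite ger0_norm ?powR_ge0//; apply: ge0_ler_powR; rewrite ?nnegrE//.
by rewrite -(ger0_norm (f0 x)) fC.
Qed.

Lemma admissible_max f g : admissible f -> admissible g ->
  admissible (fun x => Num.max (f x) (g x)).
Proof.
move=> [mf [C C0 fC]] [mg [D D0 gD]]; split; first exact: measurable_maxr.
exists (C + D) => [|x x1]; first exact: addr_ge0.
have := fC x x1; have := gD x x1.
by have [_|_] := leP (f x) (g x); lra.
Qed.

Lemma admissible_sum (I : Type) (s : seq I) (F : I -> 'cV[R]_n -> R) :
  (forall i, admissible (F i)) -> admissible (fun x => \sum_(i <- s) F i x).
Proof.
move=> aF; elim: s => [|i s IH].
  by under eq_fun do rewrite big_nil; exact: admissible_cst.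
by under eq_fun do rewrite big_cons; exact: admissible_add.
Qed.

Lemma admissible_bigmax (I : Type) (s : seq I) (F : I -> 'cV[R]_n -> R) :
  (forall i, admissible (F i)) ->
  admissible (fun x => \big[Num.max/0]_(i <- s) F i x).
Proof.
move=> aF; elim: s => [|i s IH].
  by under eq_fun do rewrite big_nil; exact: admissible_cst.
by under eq_fun do rewrite big_cons; exact: admissible_max.
Qed.

Lemma admissible_coord k : admissible (fun x : 'cV[R]_n => x k 0).
Proof.
split; last by exists 1 => // x; exact: inner_sphere_coord.
apply: (measurability _ (RGenOpens.measurableE R)).
move=> _ [_ [a [b ->] <-]]; rewrite setTI; apply: sub_sigma_algebra => /=.
by move/continuousP : (@coord_continuous R n 1 k 0); apply; exact: interval_open.
Qed.

Lemma admissible_inner u : admissible (inner u).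
Proof.
apply: admissible_sum => k; apply: admissible_scale; exact: admissible_coord.
Qed.

End Admissible.

(** * Expectation over the sphere *)

Section SphereExpectation.
Context {R : realType} {n : nat} {d : measure_display} {T : measurableType d}.
Context {P : probability T R} {e : T -> 'cV[R]_n} (he : uniform_on_sphere P e).
Implicit Types (f g : 'cV[R]_n -> R) (u v x : 'cV[R]_n).

Local Notation Ex := (sphere_mean P e).

Lemma ae_sphere : {ae P, forall w, inner (e w) (e w) = 1}.
Proof.
case: he => _ + _; apply: filterS => w.
rewrite lqnorm2E => h; rewrite -(sqr_sqrtr (inner_ge0 _)) h expr1n//.
Qed.

Lemma measurable_comp_sphere g : admissible g ->
  measurable_fun [set: T] (fun w => g (e w)).
Proof.
move=> [mg _] _ A mA; rewrite setTI.
case: he => me _ _; apply: (me (g @^-1` A)).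
by have := mg measurableT A mA; rewrite setTI.
Qed.

Lemma integrable_sphere g : admissible g ->
  P.-integrable [set: T] (EFin \o (fun w => g (e w))).
Proof.
move=> ag; have mg := measurable_comp_sphere ag.
apply/integrableP; split; first exact/measurable_EFinP.
case: ag => _ [C C0 gC].
apply: (@le_lt_trans _ _ (C%:E * P [set: T])%E).
  apply: integral_le_bound => //; first exact/measurable_EFinP.
  by apply: filterS ae_sphere => w w1 _ /=; rewrite lee_fin gC.
by rewrite probability_setT mule1 ltry.
Qed.

Lemma expectation_Ex g : admissible g -> ('E_P[fun w => g (e w)] = (Ex g)%:E)%E.
Proof.
move=> ag; rewrite unlock /sphere_mean /Rintegral fineK//.
by apply: integrable_fin_num => //; exact: integrable_sphere.
Qed.

Lemma Ex_cst (c : R) : Ex (fun=> c) = c.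
Proof.
by apply: EFin_inj; rewrite -expectation_Ex ?expectation_cst//; exact: admissible_cst.
Qed.

Lemma Ex_add f g : admissible f -> admissible g ->
  Ex (fun x => f x + g x) = Ex f + Ex g.
Proof. by move=> af ag; apply: RintegralD => //; exact: integrable_sphere. Qed.

Lemma Ex_scale (c : R) f : admissible f -> Ex (fun x => c * f x) = c * Ex f.
Proof. by move=> af; apply: RintegralZl => //; exact: integrable_sphere. Qed.

Lemma Ex_sum (I : Type) (s : seq I) (F : I -> 'cV[R]_n -> R) :
  (forall i, admissible (F i)) ->
  Ex (fun x => \sum_(i <- s) F i x) = \sum_(i <- s) Ex (F i).
Proof.
move=> aF; elim: s => [|i s IH].
  by under eq_fun do rewrite big_nil; rewrite big_nil Ex_cst.
under eq_fun do rewrite big_cons.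
by rewrite big_cons Ex_add ?IH//; exact: admissible_sum.
Qed.

(** Positivity is needed on the sphere only: there the integrand coincides with
    its absolute value. *)
Lemma Ex_ge0 g : admissible g -> (forall x, inner x x = 1 -> 0 <= g x) ->
  0 <= Ex g.
Proof.
move=> ag g0.
have -> : Ex g = Ex (fun x => `|g x|).
  rewrite /sphere_mean /Rintegral; congr fine; apply: ae_eq_integral => //.
  - exact/measurable_EFinP/measurable_comp_sphere.
  - exact/measurable_EFinP/(measurable_comp_sphere (admissible_norm ag)).
  by apply: filterS ae_sphere => w w1 _; rewrite ger0_norm ?g0.
exact: Rintegral_ge0.
Qed.

Lemma Ex_le f g : admissible f -> admissible g ->
  (forall x, inner x x = 1 -> f x <= g x) -> Ex f <= Ex g.
Proof.
move=> af ag fg; rewrite -subr_ge0 -mulN1r -Ex_scale// -Ex_add//; last first.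
  exact: admissible_scale.
apply: Ex_ge0 => [|x x1]; first by apply: admissible_add => //; exact: admissible_scale.
by rewrite mulN1r subr_ge0 fg.
Qed.

(** Both sides are integrals of the identity against the laws of two real random
    variables, and these laws agree by rotation invariance. *)
Lemma Ex_rotation (Q : 'M[R]_n) g : orthogonal_mx Q -> admissible g ->
  admissible (fun x => g (Q *m x)) -> Ex (fun x => g (Q *m x)) = Ex g.
Proof.
move=> oQ ag aQg.
have mg := measurable_comp_sphere ag; have mQg := measurable_comp_sphere aQg.
rewrite /sphere_mean /Rintegral; congr fine.
have pf (h : T -> R) : measurable_fun setT h -> P.-integrable setT (EFin \o h) ->
    (\int[P]_w (h w)%:E = \int[pushforward P h]_y y%:E)%E.
  by move=> mh ih; rewrite (integral_pushforward mh).
rewrite pf//; last exact: integrable_sphere aQg.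
rewrite [RHS]pf//; last exact: integrable_sphere ag.
apply: eq_measure_integral => A mA _; rewrite /pushforward.
case: he => _ _ /(_ Q oQ (g @^-1` A)); apply.
by have := ag.1 measurableT A mA; rewrite setTI.
Qed.

(** The reflection in the hyperplane orthogonal to [v] fixes [inner u x] and
    changes the sign of [inner v x]. *)
Lemma Ex_orthogonal (phi : R -> R) u v : inner u v = 0 ->
  admissible (fun x => phi (inner u x)) ->
  Ex (fun x => phi (inner u x) * inner v x) = 0.
Proof.
move=> uv aphi.
have av := admissible_mul aphi (admissible_inner v).
have [v0|v0] := eqVneq (inner v v) 0.
  rewrite (_ : (fun x => _) = fun=> 0) ?Ex_cst//; apply/funext => x.
  by rewrite (inner_eq0 v0) -(scale0r v) innerZl mul0r mulr0.
have E1 x : phi (inner u (reflection v *m x)) * inner v (reflection v *m x)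
    = -1 * (phi (inner u x) * inner v x).
  rewrite !reflectionE -scaleNr !(innerC _ (x + _)) !innerDl !innerZl.
  rewrite (innerC v u) uv mulr0 addr0 (innerC x u) (innerC x v).
  have -> : inner v x + - (2 * inner v x / inner v v) * inner v v = - inner v x.
    by field.
  by rewrite mulN1r mulrN.
have := @Ex_rotation (reflection v) _ (reflection_orthogonal v0) av.
rewrite (funext E1) Ex_scale// => /(_ (admissible_scale _ av)).
lra.
Qed.

End SphereExpectation.

(** * Moments of one component *)

Section Moments.
Context {R : realType} {n : nat} {d : measure_display} {T : measurableType d}.
Context {P : probability T R} {e : T -> 'cV[R]_n} (he : uniform_on_sphere P e).
Implicit Types (f g : 'cV[R]_n -> R) (s u v w x : 'cV[R]_n).
Local Notation Ex := (sphere_mean P e).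

Lemma admissible_absmoment r u : 0 <= r ->
  admissible (fun x => `|inner u x| `^ r).
Proof.
move=> r0; apply: (admissible_powR r0) => //.
exact/admissible_norm/admissible_inner.
Qed.

Lemma admissible_spow r u : 0 <= r -> admissible (fun x => spow r (inner u x)).
Proof.
move=> r0; apply: admissible_mul; first exact: admissible_inner.
exact: admissible_absmoment.
Qed.

Lemma admissible_mixed r u w : 0 <= r ->
  admissible (fun x => `|inner u x| `^ r * inner w x ^+ 2).
Proof.
move=> r0; apply: admissible_mul; first exact: admissible_absmoment.
exact/admissible_exp/admissible_inner.
Qed.

(** The first-order expansion in [t] behind [moment_by_parts], with explicit
    error terms: the increment of [spow r] between [U] and [U + t * W] is
    controlled by the Lipschitz bound. Against [W] it gives the term that
    survives, against [t * c * U] an error of order [t ^ 2]. *)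
Lemma moment_by_parts_pointwise (r B c t eta U W : R) : 0 <= r -> 1 <= B ->
  0 <= c -> 0 < t -> t <= 1 -> `|U| <= B -> `|W| <= B ->
  (`|U| + t * `|W|) `^ r <= `|U| `^ r + eta -> 0 <= eta ->
  spow r (U + t * W) * (W - t * c * U) - spow r U * W <=
  t * (r + 1) * (`|U| `^ r * W ^+ 2) +
   (t * (r + 1) * eta * B ^+ 2 + t ^+ 2 * c * ((r + 1) * B ^+ 2 * (2 * B) `^ r)
    - t * c * (`|U| `^ r * U ^+ 2)).
Proof.
move=> r0 B1 c0 t0 t1 UB WB cont eta0.
set D := spow r (U + t * W) - spow r U.
set K := `|U| + t * `|W|.
have tW : `|t * W| = t * `|W| by rewrite normrM (gtr0_norm t0).
have tW0 : 0 <= t * `|W| by rewrite mulr_ge0// ltW.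
have DE : `|D| <= (r + 1) * (t * `|W|) * K `^ r.
  have := @spow_lipschitz R r K (U + t * W) U r0.
  rewrite (addrC U) addrK tW addrC; apply.
    by rewrite (le_trans (ler_normD _ _))// tW.
  by rewrite lerDl.
have KB : K `^ r <= (2 * B) `^ r.
  apply: ge0_ler_powR; rewrite ?nnegrE ?addr_ge0//; first lra.
  have : t * `|W| <= 1 * B by apply: ler_pM => //; exact: ltW.
  by rewrite /K; lra.
have K0 : 0 <= K `^ r := powR_ge0 _ _.
have DW : D * W <= t * (r + 1) * (`|U| `^ r * W ^+ 2) + t * (r + 1) * eta * B ^+ 2.
  rewrite (le_trans (ler_norm _))// normrM.
  apply: (@le_trans _ _ ((r + 1) * (t * `|W|) * K `^ r * `|W|)).
    by rewrite ler_wpM2r.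
  have -> : (r + 1) * (t * `|W|) * K `^ r * `|W| = t * (r + 1) * (K `^ r * `|W| ^+ 2).
    ring.
  rewrite -[t * (r + 1) * eta * _]mulrA -mulrDr ler_pM2l ?mulr_gt0//; last lra.
  rewrite real_normK ?num_real//.
  have W2 : W ^+ 2 <= B ^+ 2.
    by rewrite -real_normK ?num_real// ler_pXn2r// nnegrE; lra.
  apply: (@le_trans _ _ ((`|U| `^ r + eta) * W ^+ 2)).
    by rewrite ler_wpM2r// sqr_ge0.
  by rewrite mulrDl lerD2l ler_wpM2l.
have DU : - (D * U) <= t * ((r + 1) * B ^+ 2 * (2 * B) `^ r).
  rewrite (le_trans (ler_norm _))// normrN normrM.
  apply: (@le_trans _ _ ((r + 1) * (t * B) * (2 * B) `^ r * B)).
    apply: ler_pM => //; apply: (le_trans DE).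
    apply: ler_pM => //; first by rewrite !mulr_ge0//; lra.
    rewrite ler_pM2l; last lra.
    by rewrite ler_pM2l.
  by rewrite le_eqVlt; apply/orP; left; apply/eqP; ring.
have tc0 : 0 <= t * c by rewrite mulr_ge0// ltW.
have := ler_wpM2l tc0 DU.
have -> : spow r (U + t * W) * (W - t * c * U) - spow r U * W =
  D * W + t * c * - (D * U) - t * c * (`|U| `^ r * U ^+ 2).
  by rewrite /D /spow; ring.
move: DW; lra.
Qed.

(** Integration by parts on the sphere. With [U] and [W] the components of the
    random vector along [u] and [w], and [c] the squared norm of [w], the
    vectors [u + t w] and [w - t c u] are orthogonal for every [t], so
    [spow r (U + t W) (W - t c U)] has mean zero. The derivative at [t = 0] of
    this identity is the conclusion, with equality. The inequality follows
    from the pointwise upper bound above by letting [t] tend to 0. *)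
Lemma moment_by_parts r u w : 0 <= r -> inner u u = 1 -> inner u w = 0 ->
  inner w w * Ex (fun x => `|inner u x| `^ r * inner u x ^+ 2) <=
  (r + 1) * Ex (fun x => `|inner u x| `^ r * inner w x ^+ 2).
Proof.
move=> r0 u1 uw; set c := inner w w; set M := Ex _; set N := Ex _.
have c0 : 0 <= c := inner_ge0 w.
apply/ler_addgt0Pr => eps eps0.
have [_ [C C0 uC]] := admissible_inner u; have [_ [D D0 wD]] := admissible_inner w.
pose B := C + D + 1.
have B1 : 1 <= B by rewrite /B; lra.
(* Chosen so that (r + 1) eta B ^ 2 = eps / 2. *)
pose eta := eps / 2 / ((r + 1) * B ^+ 2).
have B20 : 0 < (r + 1) * B ^+ 2 by rewrite mulr_gt0 ?exprn_gt0//; lra.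
have eta0 : 0 < eta by rewrite !divr_gt0.
have [dl [dl0 dl1 cont]] := powR_uniformly_continuous B r0 eta0.
pose K := (r + 1) * B ^+ 2 * (2 * B) `^ r.
have K0 : 0 <= K by rewrite mulr_ge0 ?powR_ge0// ltW.
have cK0 : 0 < c * K + 1 by rewrite ltr_wpDl// mulr_ge0.
(* The first bound on t keeps t W within the modulus of uniform continuity,
   the second makes the second-order error at most eps / 2. *)
pose t := Num.min (dl / B) (eps / 2 / (c * K + 1)).
have t0 : 0 < t by rewrite lt_min !divr_gt0//; lra.
have tB : t * B <= dl by rewrite -ler_pdivlMr; [rewrite ge_min lexx|lra].
have tK : t * (c * K + 1) <= eps / 2 by rewrite -ler_pdivlMr// ge_min lexx orbT.
have t1 : t <= 1 by nra.
(* The constant k is kept opaque so that linearity does not split it. *)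
have [k kE] : exists k, k = t * (r + 1) * eta * B ^+ 2 + t ^+ 2 * c * K by eexists.
have au := admissible_mixed u u r0; have aw := admissible_mixed u w r0.
have asw := admissible_mul (admissible_spow (u + t *: w) r0)
  (admissible_inner (w - (t * c) *: u)).
have as0 := admissible_mul (admissible_spow u r0) (admissible_inner w).
have ag : admissible (fun x => k + - (t * c) * (`|inner u x| `^ r * inner u x ^+ 2)).
  by apply: admissible_add; [exact: admissible_cst|exact: admissible_scale].
have := @Ex_le R n d T P e he
  (fun x => spow r (inner (u + t *: w) x) * inner (w - (t * c) *: u) x +
     -1 * (spow r (inner u x) * inner w x))
  (fun x => t * (r + 1) * (`|inner u x| `^ r * inner w x ^+ 2) +
     (k + - (t * c) * (`|inner u x| `^ r * inner u x ^+ 2))).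
rewrite !(Ex_add he)//; do ?[exact: admissible_scale|exact: admissible_cst].
rewrite !(Ex_scale he)// (Ex_cst he) -/M -/N.
rewrite (Ex_orthogonal he uw (admissible_spow u r0)).
rewrite (Ex_orthogonal he _ (admissible_spow _ r0)); last first.
  rewrite innerDl innerZl !(innerC _ (w - _)) -scaleNr !innerDl !innerZl.
  by rewrite u1 (innerC w u) uw -/c; ring.
move=> H.
have {}H : 0 + -1 * 0 <= t * (r + 1) * N + (k + - (t * c) * M).
  apply: H => [||x x1].
  - by apply: admissible_add => //; exact: admissible_scale.
  - by apply: admissible_add => //; exact: admissible_scale.
  rewrite mulN1r mulNr kE innerDl innerZl -scaleNr innerDl innerZl mulNr.
  have uB : `|inner u x| <= B by have := uC x x1; rewrite /B; lra.
  have wB : `|inner w x| <= B by have := wD x x1; rewrite /B; lra.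
  apply: moment_by_parts_pointwise => //; last exact: ltW.
  apply: cont => //; first by rewrite mulr_ge0// ltW.
  by rewrite (le_trans _ tB)// ler_pM2l.
have etaE : (r + 1) * eta * B ^+ 2 = eps / 2.
  by rewrite /eta; field; rewrite !gt_eqF//; lra.
have : 0 <= t * ((r + 1) * N + eps / 2 + t * c * K - c * M).
  move: H; rewrite mulr0 add0r => /le_trans; apply.
  by rewrite le_eqVlt; apply/orP; left; apply/eqP; rewrite -etaE kE; ring.
rewrite pmulr_rge0//.
lra.
Qed.

(** Summing [moment_by_parts] over the projected basis vectors
    [w_k = delta_k - u_k u]: their squared norms add up to [n - 1], and the
    squares of the components along them to [1 - U ^ 2]. *)
Lemma moment_recursion r u : 0 <= r -> inner u u = 1 ->
  (n%:R + r) * Ex (fun x => `|inner u x| `^ r * inner u x ^+ 2) <=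
  (r + 1) * Ex (fun x => `|inner u x| `^ r).
Proof.
move=> r0 u1; set M := Ex _; set N := Ex _.
pose w (k : 'I_n) : 'cV[R]_n := delta_mx k 0 - u k 0 *: u.
have uw k : inner u (w k) = 0.
  by rewrite innerC /w -scaleNr innerDl innerZl inner_delta u1 mulr1 subrr.
have wE k : inner (w k) (w k) = 1 - u k 0 * u k 0.
  rewrite [X in inner X]/w -scaleNr innerDl innerZl uw mulr0 addr0 inner_delta.
  by rewrite !mxE !eqxx.
have aw k : admissible (fun x => `|inner u x| `^ r * inner (w k) x ^+ 2).
  exact: admissible_mixed.
have au := admissible_mixed u u r0; have ar := admissible_absmoment u r0.
have H : \sum_(k < n) inner (w k) (w k) * M <=
    \sum_(k < n) (r + 1) * Ex (fun x => `|inner u x| `^ r * inner (w k) x ^+ 2).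
  by apply: ler_sum => k _; exact: moment_by_parts.
move: H; rewrite -mulr_suml -mulr_sumr (eq_bigr _ (fun k _ => wE k)).
rewrite sumrB sumr_const card_ord -/(inner u u) u1 -(Ex_sum he)//.
have : Ex (fun x => \sum_(k < n) `|inner u x| `^ r * inner (w k) x ^+ 2) <= N - M.
  rewrite -[- M]mulN1r -(Ex_scale he)// -(Ex_add he)//; last exact: admissible_scale.
  apply: (Ex_le he); first exact: admissible_sum.
    by apply: admissible_add => //; exact: admissible_scale.
  move=> x x1; rewrite -mulr_sumr sum_inner_tangent// x1.
  by rewrite le_eqVlt; apply/orP; left; apply/eqP; ring.
have r1 : 0 < r + 1 by lra.
rewrite -(ler_pM2l r1).
lra.
Qed.

(** Jensen's inequality for a concave power. *)
Lemma Ex_powR_le (theta m : R) g : 0 <= theta -> theta <= 1 -> 0 < m ->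
  (forall x, 0 <= g x) -> admissible g -> Ex g <= m ->
  Ex (fun x => g x `^ theta) <= m `^ theta.
Proof.
move=> t0 t1 m0 g0 ag gm.
pose k := m `^ theta * (1 - theta); pose c := m `^ theta * theta / m.
have c0 : 0 <= c by rewrite divr_ge0 ?mulr_ge0 ?powR_ge0// ltW.
apply: (@le_trans _ _ (Ex (fun x => k + c * g x))).
  apply: (Ex_le he); first exact: admissible_powR.
    by apply: admissible_add; [exact: admissible_cst|exact: admissible_scale].
  move=> x _; apply: (le_trans (powR_le_tangent t0 t1 m0 (g0 x))).
  by rewrite le_eqVlt; apply/orP; left; apply/eqP; rewrite /k /c; ring.
have ak : @admissible R n (fun=> k) := admissible_cst k.
rewrite (Ex_add he ak (admissible_scale c ag)) (Ex_scale he)// (Ex_cst he).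
have := ler_wpM2l c0 gm.
have -> : c * m = m `^ theta * theta by rewrite /c divfK ?gt_eqF.
rewrite /k; lra.
Qed.

(** Let [M] be the moment of order [p]. The one of order [p - 2] is at most
    [M ^ (1 - 2 / p)] by Jensen's inequality, hence
    [(n + p - 2) M <= (p - 1) M ^ (1 - 2 / p)], which is solved for [M]. *)
Lemma absmoment_le p u : 2 <= p -> (0 < n)%N -> inner u u = 1 ->
  Ex (fun x => `|inner u x| `^ p) <= ((p - 1) / n%:R) `^ (p / 2).
Proof.
move=> p2 n0 u1.
have n0R : 0 < n%:R :> R by rewrite ltr0n.
have r0 : 0 <= p - 2 by lra.
have p0 : 0 < p by lra.
set M := Ex _.
have [M0|M0] := leP M 0; first by rewrite (le_trans M0)// powR_ge0.
have ME : M = Ex (fun x => `|inner u x| `^ (p - 2) * inner u x ^+ 2).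
  congr (Ex _); apply/funext => x.
  rewrite -[in LHS](subrK 2 p) powRD; last by rewrite subrK gt_eqF.
  by rewrite powR_mulrn// real_normK ?num_real.
have ap : admissible (fun x => `|inner u x| `^ p).
  by apply: admissible_absmoment; exact: ltW.
have th0 : 0 <= (p - 2) / p by rewrite divr_ge0// ltW.
have th1 : (p - 2) / p <= 1 by rewrite ler_pdivrMr//; lra.
have := Ex_powR_le th0 th1 M0 (fun x => powR_ge0 _ _) ap (lexx _).
under eq_fun do rewrite -powRrM mulrCA mulfV ?gt_eqF// mulr1.
move=> J.
have := moment_recursion r0 u1; rewrite -ME => rec.
have {J} : (n%:R + (p - 2)) * M <= (p - 2 + 1) * M `^ ((p - 2) / p).
  by apply: (le_trans rec); rewrite ler_wpM2l//; lra.
have -> : (p - 2) / p = 1 - 2 / p by rewrite mulrBl mulfV ?gt_eqF.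
rewrite powRB; last by rewrite (gt_eqF M0) implybT.
rewrite powRr1 ?(ltW M0)// => J.
have A0 : 0 < M `^ (2 / p) by exact: powR_gt0.
have {}J : M `^ (2 / p) <= (p - 1) / n%:R.
  rewrite ler_pdivlMr// -(ler_pM2r M0).
  have := ler_wpM2r (ltW A0) J.
  have -> : (p - 2 + 1) * (M / M `^ (2 / p)) * M `^ (2 / p) = (p - 1) * M.
    by field; rewrite gt_eqF.
  have : 0 <= (p - 2) * M * M `^ (2 / p) by rewrite !mulr_ge0// ltW.
  lra.
have -> : M = (M `^ (2 / p)) `^ (p / 2).
  rewrite -powRrM (_ : 2 / p * (p / 2) = 1) ?powRr1 ?ltW//.
  by field; rewrite gt_eqF.
apply: ge0_ler_powR; rewrite ?nnegrE ?powR_ge0 ?divr_ge0//; lra.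
Qed.

(** Two steps of the recursion, from order 0 to 2 and from 2 to 4. They
    give the constant 3, where [absmoment_le] with [p = 4] would give 9. *)
Lemma fourth_moment_le s : (0 < n)%N ->
  Ex (fun x => inner s x ^+ 4) <= 3 * inner s s ^+ 2 / n%:R ^+ 2.
Proof.
move=> n0.
have n0R : 0 < n%:R :> R by rewrite ltr0n.
have [s0|s0] := eqVneq (inner s s) 0.
  rewrite s0 expr0n mulr0 mul0r (_ : (fun x => _) = fun=> 0) ?(Ex_cst he)//.
  by apply/funext => x; rewrite (inner_eq0 s0) -(scale0r s) innerZl mul0r expr0n.
pose N := Num.sqrt (inner s s).
have N0 : 0 < N by rewrite sqrtr_gt0 lt_neqAle eq_sym s0 inner_ge0.
have NE : N ^+ 2 = inner s s by rewrite sqr_sqrtr ?inner_ge0.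
pose u := N^-1 *: s.
have u1 : inner u u = 1.
  by rewrite innerZl innerC innerZl -NE; field; rewrite gt_eqF.
have suE x : inner s x = N * inner u x by rewrite innerZl mulVKf ?gt_eqF.
have a2 : admissible (fun x => inner u x ^+ 2) by exact/admissible_exp/admissible_inner.
have a4 : admissible (fun x => inner u x ^+ 4) by exact/admissible_exp/admissible_inner.
have M2 : n%:R * Ex (fun x => inner u x ^+ 2) <= 1.
  have := moment_recursion (lexx 0) u1.
  under eq_fun do rewrite powRr0 mul1r.
  under [X in _ <= _ * Ex X]eq_fun do rewrite powRr0.
  by rewrite (Ex_cst he) addr0 add0r mulr1.
have M4 : (n%:R + 2) * Ex (fun x => inner u x ^+ 4) <= 3 * Ex (fun x => inner u x ^+ 2).
  have := moment_recursion (ler0n _ 2) u1.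
  have E2 x : `|inner u x| `^ 2 = inner u x ^+ 2.
    by rewrite powR_mulrn// real_normK ?num_real.
  rewrite (funext E2).
  under eq_fun do rewrite E2 -exprD.
  by rewrite (_ : 2 + 1 = 3)//; ring.
have M40 : 0 <= Ex (fun x => inner u x ^+ 4).
  by apply: (Ex_ge0 he) => // x _; rewrite (exprM _ 2 2) sqr_ge0.
under eq_fun do rewrite suE exprMn.
rewrite (Ex_scale he)// -NE -exprM ler_pdivlMr ?exprn_gt0//.
rewrite -mulrA [3 * _]mulrC ler_pM2l ?exprn_gt0//.
have : n%:R * (n%:R * Ex (fun x => inner u x ^+ 4)) <= n%:R * (3 * Ex (fun x => inner u x ^+ 2)).
  by rewrite ler_pM2l//; lra.
lra.
Qed.

End Moments.

(** * The norms *)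

Section Norms.
Context {R : realType} {n : nat}.
Implicit Types (x : 'cV[R]_n) (q : \bar R) (r : R).

Lemma powsum_ge0 r x : 0 <= \sum_(k < n) `|x k 0| `^ r.
Proof. by apply: sumr_ge0 => k _; exact: powR_ge0. Qed.

Lemma lqnorm_ge0 q x : 0 <= lqnorm q x.
Proof.
case: q => [r||] //=; first exact: powR_ge0.
by elim/big_ind: _ => // a b a0 b0; rewrite le_max a0.
Qed.

Lemma lqnormX r k x :
  lqnorm r%:E x ^+ k = (\sum_(i < n) `|x i 0| `^ r) `^ (k%:R / r).
Proof. by rewrite /= -powR_mulrn ?powR_ge0// -powRrM mulrC. Qed.

Lemma coord_le_lqnorm r k x : 0 < r -> `|x k 0| <= lqnorm r%:E x.
Proof.
move=> r0 /=.
rewrite -[leLHS]powRr1// -(mulfV (lt0r_neq0 r0)) powRrM.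
apply: ge0_ler_powR; rewrite ?nnegrE ?powR_ge0 ?powsum_ge0 ?invr_ge0 ?(ltW r0)//.
by rewrite (bigD1 k)//= lerDl sumr_ge0// => i _; exact: powR_ge0.
Qed.

(** Each coordinate is at most the smaller-exponent norm [N], so
    [|x_k| ^ p <= |x_k| ^ r N ^ (p - r)], and summing gives [N ^ p]. *)
Lemma lqnorm_antitone r q x : 0 < r -> (r%:E <= q)%E ->
  lqnorm q x <= lqnorm r%:E x.
Proof.
move=> r0; case: q => [p||] //=; last first.
  move=> _; elim/big_ind: _ => [|a b a0 b0|k _]; first exact: powR_ge0.
    by rewrite ge_max a0.
  exact: coord_le_lqnorm.
rewrite lee_fin => rp; have p0 : 0 < p by exact: lt_le_trans rp.
set N := _ `^ r^-1.
have N0 : 0 <= N by exact: powR_ge0.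
have NE : N `^ r = \sum_(k < n) `|x k 0| `^ r.
  by rewrite /N -powRrM mulVf ?gt_eqF// powRr1// powsum_ge0.
have H : \sum_(k < n) `|x k 0| `^ p <= N `^ p.
  have -> : N `^ p = N `^ r * N `^ (p - r).
    by rewrite -powRD; rewrite addrC subrK// gt_eqF.
  rewrite NE mulr_suml; apply: ler_sum => k _.
  have -> : `|x k 0| `^ p = `|x k 0| `^ r * `|x k 0| `^ (p - r).
    by rewrite -powRD; rewrite addrC subrK// gt_eqF.
  rewrite ler_wpM2l ?powR_ge0//; apply: ge0_ler_powR; rewrite ?nnegrE ?subr_ge0//.
  exact: coord_le_lqnorm.
rewrite -[leRHS]powRr1// -(mulfV (lt0r_neq0 p0)) powRrM.
by apply: ge0_ler_powR; rewrite ?nnegrE ?powR_ge0 ?powsum_ge0 ?invr_ge0 ?(ltW p0).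
Qed.

(** The sum of the squares of [n a_k - S] is nonnegative, where [S] is the sum of
    the [a_k]. *)
Lemma sqr_sum_le (a : 'I_n -> R) :
  (\sum_(k < n) a k) ^+ 2 <= n%:R * \sum_(k < n) a k ^+ 2.
Proof.
set S := \sum_(k < n) a k; set Q := \sum_(k < n) a k ^+ 2.
have [n0|n0] := posnP n.
  have -> : S = 0 by apply: big1 => k; have := ltn_ord k; rewrite [X in (_ < X)%N]n0.
  by rewrite expr0n mulr_ge0// sumr_ge0// => k _; exact: sqr_ge0.
have n0R : 0 < n%:R :> R by rewrite ltr0n.
have : 0 <= \sum_(k < n) (n%:R * a k - S) ^+ 2 by apply: sumr_ge0 => k _; exact: sqr_ge0.
rewrite (eq_bigr (fun k => n%:R ^+ 2 * a k ^+ 2 - 2 * n%:R * S * a k + S ^+ 2)); last first.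
  by move=> k _; ring.
rewrite big_split /= sumrB sumr_const card_ord -[S ^+ 2 *+ n]mulr_natl -!mulr_sumr -/S -/Q.
have -> : n%:R ^+ 2 * Q - 2 * n%:R * S * S + n%:R * S ^+ 2 = n%:R * (n%:R * Q - S ^+ 2).
  by ring.
by rewrite pmulr_rge0// subr_ge0.
Qed.

Lemma admissible_powsum r : 0 <= r ->
  admissible (fun x => \sum_(k < n) `|x k 0| `^ r).
Proof.
move=> r0; apply: admissible_sum => k; apply: admissible_powR => //.
exact/admissible_norm/admissible_coord.
Qed.

Lemma admissible_lqnorm q : (0 < q)%E -> @admissible R n (lqnorm q).
Proof.
case: q => [r||] //= r0; last first.
  by apply: admissible_bigmax => k; exact/admissible_norm/admissible_coord.
apply: admissible_powR.
- by rewrite invr_ge0 ltW.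
- by move=> x; exact: powsum_ge0.
- by apply: admissible_powsum; exact: ltW.
Qed.

End Norms.

(** * Moments of the norms *)

Section NormMoments.
Context {R : realType} {n : nat} {d : measure_display} {T : measurableType d}.
Context {P : probability T R} {e : T -> 'cV[R]_n} (he : uniform_on_sphere P e).
Context (n_gt0 : (0 < n)%N).
Implicit Types (x s : 'cV[R]_n) (r : R).
Local Notation Ex := (sphere_mean P e).
Let n0R : 0 < n%:R :> R. Proof. by rewrite ltr0n. Qed.

Lemma Ex_powsum_le p : 2 <= p ->
  Ex (fun x => \sum_(k < n) `|x k 0| `^ p) <=
  n%:R * ((p - 1) / n%:R) `^ (p / 2).
Proof.
move=> p2.
have p0 : 0 <= p by lra.
rewrite (Ex_sum he); last first.
  by move=> k; apply: admissible_powR => //; exact/admissible_norm/admissible_coord.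
apply: (@le_trans _ _ (\sum_(k < n) ((p - 1) / n%:R) `^ (p / 2))); last first.
  by rewrite sumr_const card_ord mulr_natl.
apply: ler_sum => k _.
have u1 : inner (delta_mx k 0) (delta_mx k 0) = 1 :> R.
  by rewrite inner_delta mxE !eqxx.
have := absmoment_le he p2 n_gt0 u1.
by under eq_fun do rewrite inner_delta.
Qed.

Lemma Ex_sqr_lqnorm_le r : 2 <= r ->
  Ex (fun x => lqnorm r%:E x ^+ 2) <= (r - 1) * n%:R `^ (2 / r - 1).
Proof.
move=> r2; have r0 : 0 < r by lra.
have rn0 : 0 < (r - 1) / n%:R by rewrite divr_gt0//; lra.
under eq_fun do rewrite lqnormX.
have th0 : 0 <= 2 / r by rewrite divr_ge0// ltW.
have th1 : 2 / r <= 1 by rewrite ler_pdivrMr// mul1r.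
have m0 : 0 < n%:R * ((r - 1) / n%:R) `^ (r / 2) by rewrite mulr_gt0// powR_gt0.
apply: le_trans (Ex_powR_le he th0 th1 m0 _ _ (Ex_powsum_le r2)) _.
- by move=> x; exact: powsum_ge0.
- by apply: admissible_powsum; exact: ltW.
rewrite powRM ?powR_ge0 ?ler0n// -powRrM (_ : r / 2 * (2 / r) = 1); last first.
  by field; rewrite gt_eqF.
rewrite powRr1 ?(ltW rn0)// powRB ?powRr1 ?ler0n//; last by rewrite (gt_eqF n0R) implybT.
by rewrite le_eqVlt; apply/orP; left; apply/eqP; ring.
Qed.

(** By Cauchy-Schwarz for sums, the square of the sum of the [|x_k| ^ r] is at
    most [n] times the sum of the [|x_k| ^ (2 r)]; this makes moments of order
    [2 r] available, and with them the concave power [2 / r], whereas the power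
    [4 / r] of the first sum is not concave for [r < 4]. *)
Lemma Ex_lqnorm4_le r : 2 <= r ->
  Ex (fun x => lqnorm r%:E x ^+ 4) <= ((2 * r - 1) * n%:R `^ (2 / r - 1)) ^+ 2.
Proof.
move=> r2; have r0 : 0 < r by lra.
have rn0 : 0 < (2 * r - 1) / n%:R by rewrite divr_gt0//; lra.
have r22 : 2 <= 2 * r by lra.
have th0 : 0 <= 2 / r by rewrite divr_ge0// ltW.
have th1 : 2 / r <= 1 by rewrite ler_pdivrMr// mul1r.
have ar : @admissible R n (fun x => \sum_(k < n) `|x k 0| `^ (2 * r)).
  by apply: admissible_powsum; lra.
pose g x := n%:R * \sum_(k < n) `|x k 0| `^ (2 * r).
have ag : admissible g by exact: admissible_scale.
have g0 x : 0 <= g x by rewrite mulr_ge0 ?powsum_ge0.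
pose m : R := n%:R * (n%:R * ((2 * r - 1) / n%:R) `^ (2 * r / 2)).
have m0 : 0 < m by rewrite !mulr_gt0// powR_gt0.
have gm : Ex g <= m by rewrite (Ex_scale he)// ler_pM2l// Ex_powsum_le.
apply: (@le_trans _ _ (Ex (fun x => g x `^ (2 / r)))).
  apply: (Ex_le he).
  - by apply/admissible_exp/admissible_lqnorm; rewrite lte_fin.
  - exact: admissible_powR.
  move=> x _; rewrite lqnormX.
  rewrite (_ : 4%:R / r = 2 * (2 / r)); last by field; rewrite gt_eqF.
  rewrite powRrM; apply: ge0_ler_powR; rewrite ?nnegrE ?powR_ge0//.
  rewrite powR_mulrn ?powsum_ge0//; apply: (le_trans (sqr_sum_le _)).
  rewrite /g ler_pM2l//; apply: ler_sum => k _.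
  by rewrite mulrC powRrM powR_mulrn// powR_ge0.
apply: le_trans (Ex_powR_le he th0 th1 m0 g0 ag gm) _.
have c0 : 0 <= ((2 * r - 1) / n%:R) `^ (2 * r / 2) := powR_ge0 _ _.
have n0 : 0 <= n%:R :> R := ltW n0R.
rewrite /m powRM ?mulr_ge0// (powRM _ n0 c0) -powRrM.
rewrite (_ : 2 * r / 2 * (2 / r) = 2); last by field; rewrite gt_eqF.
rewrite powR_mulrn ?(ltW rn0)// powRB ?powRr1 ?ler0n//; last by rewrite (gt_eqF n0R) implybT.
by rewrite le_eqVlt; apply/orP; left; apply/eqP; ring.
Qed.

(** The Cauchy-Schwarz inequality for the fourth moments of [inner s x] and of
    the norm, in the form of the AM-GM inequality with an optimal weight. *)
Lemma Ex_inner_lqnorm_le s r : 2 <= r ->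
  Ex (fun x => inner s x ^+ 2 * lqnorm r%:E x ^+ 2) <=
  Num.sqrt 3 * inner s s * (2 * r - 1) * n%:R `^ (2 / r - 2).
Proof.
move=> r2; have r0 : 0 < r by lra.
have nr0 : 0 < n%:R `^ (2 / r - 1) :> R by exact: powR_gt0.
have -> : 2 / r - 2 = (2 / r - 1) - 1 by ring.
rewrite [_ `^ (_ - 1 - 1)]powRB; last by rewrite (gt_eqF n0R) implybT.
rewrite powRr1 ?ler0n//.
have [s0|s0] := eqVneq (inner s s) 0.
  rewrite s0 mulr0 !mul0r (_ : (fun x => _) = fun=> 0) ?(Ex_cst he)//.
  apply/funext => x; rewrite (inner_eq0 s0) -(scale0r s) innerZl mul0r.
  by rewrite expr0n mul0r.
have S0 : 0 < inner s s by rewrite lt_neqAle eq_sym s0 inner_ge0.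
pose a := Num.sqrt 3 * inner s s / n%:R.
have a0 : 0 < a by rewrite divr_gt0// mulr_gt0// sqrtr_gt0.
pose b := (2 * r - 1) * n%:R `^ (2 / r - 1).
have b0 : 0 < b by rewrite mulr_gt0//; lra.
have F4 := fourth_moment_le he s n_gt0.
have aE : 3 * inner s s ^+ 2 / n%:R ^+ 2 = a ^+ 2.
  by rewrite /a !exprMn sqr_sqrtr// exprVn.
rewrite aE in F4.
have L4 := Ex_lqnorm4_le r2; rewrite -/b in L4.
have as4 : admissible (fun x => inner s x ^+ 4) by exact/admissible_exp/admissible_inner.
have aqr : @admissible R n (lqnorm r%:E) by apply: admissible_lqnorm; rewrite lte_fin.
have aq4 : admissible (fun x => lqnorm r%:E x ^+ 4) by exact/admissible_exp.
(* The weight that makes both terms of the AM-GM bound equal to a b / 2. *)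
pose l := b / a.
have l0 : 0 < l by rewrite divr_gt0.
apply: (@le_trans _ _ (Ex (fun x => l / 2 * inner s x ^+ 4 + (2 * l)^-1 * lqnorm r%:E x ^+ 4))).
  apply: (Ex_le he).
  - by apply: admissible_mul; apply: admissible_exp => //; exact: admissible_inner.
  - by apply: admissible_add; exact: admissible_scale.
  move=> x _; set A := inner s x; set B := lqnorm _ x.
  rewrite -subr_ge0.
  have -> : l / 2 * A ^+ 4 + (2 * l)^-1 * B ^+ 4 - A ^+ 2 * B ^+ 2 =
    (l * A ^+ 2 - B ^+ 2) ^+ 2 / (2 * l) by field; rewrite gt_eqF.
  by rewrite divr_ge0 ?sqr_ge0// mulr_ge0// ltW.
rewrite (Ex_add he); do ?exact: admissible_scale.
rewrite !(Ex_scale he)//.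
have h1 : l / 2 * Ex (fun x => inner s x ^+ 4) <= l / 2 * a ^+ 2.
  by rewrite ler_wpM2l// divr_ge0// ltW.
have h2 : (2 * l)^-1 * Ex (fun x => lqnorm r%:E x ^+ 4) <= (2 * l)^-1 * b ^+ 2.
  by rewrite ler_wpM2l// invr_ge0 mulr_ge0// ltW.
apply: (le_trans (lerD h1 h2)).
rewrite le_eqVlt; apply/orP; left; apply/eqP.
transitivity (a * b); first by rewrite /l; field; rewrite !gt_eqF.
by rewrite /a /b; ring.
Qed.

End NormMoments.

(** * Large exponents *)

Section LogarithmicBounds.
Context {R : realType} {n : nat} {d : measure_display} {T : measurableType d}.
Context {P : probability T R} {e : T -> 'cV[R]_n} (he : uniform_on_sphere P e).
Context (n_ge8 : (8 <= n)%N).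
Implicit Types (q : \bar R) (s : 'cV[R]_n).
Local Notation Ex := (sphere_mean P e).
Local Notation L := (ln n%:R : R).

Let n_gt0 : (0 < n)%N. Proof. exact: leq_trans n_ge8. Qed.
Let n0R : 0 < n%:R :> R. Proof. by rewrite ltr0n. Qed.
Let n8R : 8 <= n%:R :> R. Proof. by rewrite ler_nat. Qed.

Lemma expR1_le8 : expR 1 <= 8 :> R.
Proof.
have h := expR_ge1Dx (- 2^-1 : R).
have h2 : expR (2^-1) <= 2 :> R.
  have p : 0 < expR (2^-1) :> R := expR_gt0 _.
  have := ler_wpM2r (ltW p) h; rewrite -expRD addNr expR0; lra.
have -> : (1 : R) = 2^-1 + 2^-1 by field.
rewrite expRD; have p : 0 < expR (2^-1) :> R := expR_gt0 _.
nra.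
Qed.

Lemma ln_ge1 : 1 <= L.
Proof.
rewrite -[leLHS](expRK 1) ler_ln ?posrE ?expR_gt0//.
exact: le_trans expR1_le8 n8R.
Qed.

(** For the exponent [2 ln n] the factor [n ^ (2 / q)] is the constant [e]. *)
Lemma powR_log_exponent_le (theta k : R) : 0 <= theta ->
  n%:R `^ (2 / (2 * L) - k) <= 8 * n%:R `^ (theta - k).
Proof.
move=> t0; have L1 := ln_ge1.
have nz : n%:R != 0 :> R by rewrite gt_eqF.
rewrite !powRD ?nz ?implybT// mulrA ler_wpM2r ?powR_ge0//.
have -> : n%:R `^ (2 / (2 * L)) = expR 1.
  rewrite /powR (negPf nz); congr expR; field; rewrite gt_eqF//; lra.
apply: (le_trans expR1_le8); rewrite -[leLHS]mulr1 ler_wpM2l//.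
by rewrite -[leLHS](powRr0 n%:R) ler_powR//; move: n8R; lra.
Qed.

Lemma conjexp_ge0 q : (2%:E <= q)%E -> 0 <= fine (2%:E / q)%E.
Proof.
case: q => [r||] //; last by rewrite invey mule0.
by rewrite lee_fin => r2; rewrite inver gt_eqF ?(lt_le_trans _ r2)//= divr_ge0//; lra.
Qed.

(** The norm is nonincreasing in the exponent, so the bound at [2 ln n] applies,
    at the cost of the factor [e <= 8]: [8 (2 ln n - 1) = 16 ln n - 8]. *)
Lemma Ex_sqr_lqnorm_le_log q : (2%:E <= q)%E -> ((2 * L)%:E <= q)%E ->
  Ex (fun x => lqnorm q x ^+ 2) <=
  (16 * L - 8) * n%:R `^ (fine (2%:E / q)%E - 1).
Proof.
move=> q2 qL; have L1 := ln_ge1.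
have L2 : 2 <= 2 * L by lra.
have L0 : 0 < 2 * L by lra.
have q0 : (0 < q)%E by exact: lt_le_trans q2.
apply: (@le_trans _ _ (Ex (fun x => lqnorm (2 * L)%:E x ^+ 2))).
  apply: (Ex_le he) => [||x _].
  - exact/admissible_exp/admissible_lqnorm.
  - by apply/admissible_exp/admissible_lqnorm; rewrite lte_fin.
  by rewrite ler_pXn2r ?nnegrE ?lqnorm_ge0// lqnorm_antitone.
apply: (le_trans (Ex_sqr_lqnorm_le he n_gt0 L2)).
have H := powR_log_exponent_le 1 (conjexp_ge0 q2).
have h1 : 0 <= 2 * L - 1 by lra.
have := ler_wpM2l h1 H.
lra.
Qed.

(** As above, with [8 (4 ln n - 1) = 32 ln n - 8]. *)
Lemma Ex_inner_lqnorm_le_log s q : (2%:E <= q)%E -> ((2 * L)%:E <= q)%E ->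
  Ex (fun x => inner s x ^+ 2 * lqnorm q x ^+ 2) <=
  Num.sqrt 3 * inner s s * (32 * L - 8) * n%:R `^ (fine (2%:E / q)%E - 2).
Proof.
move=> q2 qL; have L1 := ln_ge1.
have L2 : 2 <= 2 * L by lra.
have L0 : 0 < 2 * L by lra.
have q0 : (0 < q)%E by exact: lt_le_trans q2.
have as2 : admissible (fun x => inner s x ^+ 2) by exact/admissible_exp/admissible_inner.
apply: (@le_trans _ _ (Ex (fun x => inner s x ^+ 2 * lqnorm (2 * L)%:E x ^+ 2))).
  apply: (Ex_le he) => [||x _].
  - by apply: admissible_mul => //; exact/admissible_exp/admissible_lqnorm.
  - by apply: admissible_mul => //; apply/admissible_exp/admissible_lqnorm; rewrite lte_fin.
  by rewrite ler_wpM2l ?sqr_ge0// ler_pXn2r ?nnegrE ?lqnorm_ge0// lqnorm_antitone.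
apply: (le_trans (Ex_inner_lqnorm_le he n_gt0 s L2)).
have H := powR_log_exponent_le 2 (conjexp_ge0 q2).
have h1 : 0 <= Num.sqrt 3 * inner s s * (2 * (2 * L) - 1).
  by rewrite !mulr_ge0 ?sqrtr_ge0 ?inner_ge0//; lra.
have := ler_wpM2l h1 H.
lra.
Qed.

End LogarithmicBounds.

Unset Implicit Arguments.

Theorem mainTheorem1 (R : realType) (n : nat) (hn : (8 <= n)%N)
    (d : measure_display) (T : measurableType d) (P : probability T R)
    (e : T -> 'cV[R]_n) (he : uniform_on_sphere P e) (s : 'cV[R]_n) :
  (forall q : \bar R, (2%:E <= q)%E ->
     ('E_P[fun w => (lqnorm q (e w) ^+ 2)%R]
      <= Order.min (q - 1) (16 * ln n%:R - 8)%R%:E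
         * (n%:R `^ (fine (2%:E / q)%E - 1))%R%:E)%E) /\
  (forall q : \bar R, (2%:E <= q)%E ->
     ('E_P[fun w => (inner s (e w) ^+ 2 * lqnorm q (e w) ^+ 2)%R]
      <= (Num.sqrt 3 * lqnorm 2%:E s ^+ 2)%R%:E
         * Order.min (2%:E * q - 1) (32 * ln n%:R - 8)%R%:E
         * (n%:R `^ (fine (2%:E / q)%E - 2))%R%:E)%E).
Proof.
have n0 : (0 < n)%N by exact: leq_trans hn.
have L1 : 1 <= ln n%:R :> R := ln_ge1 hn.
have adm q : (2%:E <= q)%E -> @admissible R n (fun x => lqnorm q x ^+ 2).
  by move=> q2; apply/admissible_exp/admissible_lqnorm; exact: lt_le_trans q2.
have dual_expE (r : R) : 2 <= r -> fine (2%:E / r%:E)%E = 2 / r.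
  by move=> r2; rewrite inver gt_eqF//; lra.
split=> q q2; last first.
  have a2 : @admissible R n (fun x => inner s x ^+ 2 * lqnorm q x ^+ 2).
    by apply: admissible_mul (adm q q2); exact/admissible_exp/admissible_inner.
  rewrite (expectation_Ex he a2) lqnorm2E sqr_sqrtr ?inner_ge0//.
  have log := Ex_inner_lqnorm_le_log he hn s q2.
  case: q q2 a2 log => [r||] // q2 a2 log; last first.
    by rewrite mulry gtr0_sg// mul1e addye// minye -!EFinM lee_fin log// leey.
  rewrite -EFinM -EFinB -EFin_min -!EFinM lee_fin.
  rewrite lee_fin in q2; rewrite lee_fin in log.
  have [rL|rL] := leP (2 * r - 1) (32 * ln n%:R - 8).
    by rewrite dual_expE// Ex_inner_lqnorm_le.
  by apply: log; lra.
rewrite (expectation_Ex he (adm q q2)).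
have log := Ex_sqr_lqnorm_le_log he hn q2.
case: q q2 log => [r||] // q2 log; last first.
  by rewrite addye// minye -!EFinM lee_fin log// leey.
rewrite -EFinB -EFin_min -!EFinM lee_fin.
rewrite lee_fin in q2; rewrite lee_fin in log.
have [rL|rL] := leP (r - 1) (16 * ln n%:R - 8).
  by rewrite dual_expE// Ex_sqr_lqnorm_le.
by apply: log; lra.
Qed.
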